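(* Let $L>0$, let $a$ satisfy (H_a), $g\in L^2(0,L)$, and let $\phi$ satisfy (H_φ) with $\phi(0)=+\infty$. Assume moreover that $\int_0^{\delta}\phi(t)\,dt=+\infty$ and $\int_{-\delta}^0\phi(t)\,dt=+\infty$ for every $\delta\in(0,1)$. Then problem (P) has no weak solution.
   Context: (H_a): $a\in L^\infty(0,L)$ and there are constants $0<\alpha<\beta$ with $\alpha\le a(x)\le\beta$ for a.e. $x\in(0,L)$. (H_φ): $\phi:\mathbb{R}\to\mathbb{R}\cup\{+\infty\}$ is continuous when $\mathbb{R}\cup\{+\infty\}$ carries its usual topology, and $\phi(s)<+\infty$ for every $s\neq0$ (since $\phi(0)=+\infty$, $\phi\ge0$ near $0$, so the integrals make sense). A weak solution of problem (P) with data $(a,g,\phi)$ is a function $u$ with $u\in H^1_0(0,L)$, $\phi(u)\in L^2(0,L)$, and $-\frac{d}{dx}(a\frac{du}{dx})=-\frac{d\phi(u)}{dx}-\frac{dg}{dx}$ in $\mathcal D'(0,L)$. *)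

(* Defs.v *)
From HB Require Import structures.
From mathcomp Require Import all_boot all_order all_algebra.
From mathcomp Require Import all_classical all_reals all_analysis.
Set Implicit Arguments. Unset Strict Implicit. Unset Printing Implicit Defensive.
Import Order.TTheory GRing.Theory Num.Theory.
Import numFieldNormedType.Exports.
Local Open Scope classical_set_scope.
Local Open Scope ring_scope.

Section Defs.
Context {R : realType}.
Local Notation mu := (@lebesgue_measure R).

Definition I0L (L : R) : set R := `]0, L[.

Definition L2 (L : R) (f : R -> R) : Prop :=
  measurable_fun (I0L L) f /\
  mu.-integrable (I0L L) (fun x => ((f x) ^+ 2)%:E).

Definition test_fun (L : R) (psi : R -> R) : Prop :=
  (forall n x, derivable (derive1n n psi) x 1) /\
  exists c d : R, [/\ 0 < c, c <= d, d < L &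
     forall x, x < c \/ d < x -> psi x = 0].

Definition weak_deriv (L : R) (u v : R -> R) : Prop :=
  forall psi, test_fun L psi ->
    (\int[mu]_(x in I0L L) (u x * derive1 psi x)%:E =
     - \int[mu]_(x in I0L L) (v x * psi x)%:E)%E.

Definition H1_with (L : R) (u v : R -> R) : Prop :=
  [/\ L2 L u, L2 L v & weak_deriv L u v].

Definition H10_with (L : R) (u v : R -> R) : Prop :=
  H1_with L u v /\
  exists psi : nat -> R -> R, (forall n, test_fun L (psi n)) /\
    ((fun n : nat => (\int[mu]_(x in I0L L) ((psi n x - u x) ^+ 2)%:E)%E)
        @ \oo --> (0 : \bar R)) /\
    ((fun n : nat => (\int[mu]_(x in I0L L) ((derive1 (psi n) x - v x) ^+ 2)%:E)%E)
        @ \oo --> (0 : \bar R)).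

Definition phi_u_L2 (L : R) (phi : R -> \bar R) (u : R -> R) : Prop :=
  {ae mu, forall x, I0L L x -> phi (u x) \is a fin_num} /\
  L2 L (fun x => fine (phi (u x))).

(* weak solution of (P) with data (a, g, phi):
   u ∈ H^1_0(0,L), phi(u) ∈ L^2(0,L) and
   -(a u')' = -(phi(u))' - g'  in D'(0,L), i.e. for every test function psi,
   ∫ a u' psi' = ∫ phi(u) psi' + ∫ g psi'. *)
Definition weak_solution (L : R) (a g : R -> R) (phi : R -> \bar R)
    (u : R -> R) : Prop :=
  exists v : R -> R,
  [/\ H10_with L u v, phi_u_L2 L phi u &
    forall psi, test_fun L psi ->
      (\int[mu]_(x in I0L L) (a x * v x * derive1 psi x)%:E =
       \int[mu]_(x in I0L L)
          ((fine (phi (u x)) + g x) * derive1 psi x)%:E)%E].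

Definition H_a (L : R) (a : R -> R) : Prop :=
  measurable_fun (I0L L) a /\
  exists alpha beta : R, [/\ 0 < alpha, alpha < beta &
    {ae mu, forall x, I0L L x -> alpha <= a x <= beta}].

Definition H_phi (phi : R -> \bar R) : Prop :=
  [/\ continuous phi, (forall s, phi s != -oo%E) &
      (forall s, s != 0 -> (phi s < +oo)%E)].

End Defs.

(* Main.v *)
Require Import Defs.
From HB Require Import structures.
From mathcomp Require Import all_boot all_order all_algebra.
From mathcomp Require Import all_classical all_reals all_analysis measurable_realfun.
From mathcomp Require Import lra.
Import Order.TTheory GRing.Theory Num.Theory.
Import numFieldNormedType.Exports.
Local Open Scope classical_set_scope.
Local Open Scope ring_scope.

Set Implicit Arguments. Unset Strict Implicit. Unset Printing Implicit Defensive.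

(** The equation itself plays no role: already [u] in H^1_0 and [phi(u)] in L^2
    are incompatible.  Let [f_n] be continuous truncations increasing to [phi^+]
    near [0], and [F_n] their primitives vanishing at [0].  Since [F_n(u)] has
    derivative [f_n(u) u'], which is dominated by [|phi(u) u'|], an L^1 function,
    [F_n(u)] is bounded independently of [n].  But [|F_n s|] tends to [+oo] for
    every [s <> 0] because [phi] is not integrable on either side of [0], and
    [u <> 0] almost everywhere because [phi(u)] is finite almost everywhere.
    The chain rule is only applied to the test functions approximating [u]. *)

(** * Real-variable preliminaries: oscillation and primitives of continuous functions *)

Lemma is_derive_continuous (R : realType) (f F : R -> R) :
  (forall x : R, is_derive x 1 F (f x)) -> continuous F.
Proof.
move=> dF x; apply: differentiable_continuous.
by apply/derivable1_diffP; case: (dF x).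
Qed.

(* The additive constant [1], independent of [f], is what makes the energy
   estimate below uniform over the truncations. *)
Lemma coarse_lipschitz (R : realType) (f : R -> R) (k : R) :
  continuous f -> (forall t, 0 <= f t <= k) -> (forall t, 1 <= `|t| -> f t = 0) ->
  exists C : R, forall s t, `|f s - f t| <= 1 + C * `|s - t|.
Proof.
move=> cf fk f0.
(* Tolerance [1 / 2] around a centre gives oscillation at most [1] between two points near that
   centre. *)
have He (x : R) : exists2 e : R, 0 < e &
    forall y, `|x - y| < e -> `|f x - f y| < 1 / 2.
  have /cvgrPdist_lt/(_ (1/2)) := cf x.
  by move=> /(_ ltac:(lra)) /nbhs_ballP[e /= e0 He]; exists e.
have near_le1 (x z y d e : R) : (forall y, `|x - y| < e -> `|f x - f y| < 1 / 2) ->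
    `|x - z| < e / 2 -> d < e / 2 -> `|z - y| < d -> `|f z - f y| <= 1.
  move=> {}He xz de zy.
  have xy : `|x - y| < e by have := ler_distD z x y; lra.
  have xz' : `|x - z| < e by have := normr_ge0 (x - z); lra.
  have := He y xy; have := He z xz'.
  have := ler_distD (f x) (f z) (f y); rewrite (distrC (f z) (f x)); lra.
(* Compactness of [[-2, 2]], in near-covering form, makes the radius uniform; only one of the two
   points has to lie in the segment. *)
have /compact_near_coveringP/(_ R 0^'+ (fun d x =>
    forall y, `|x - y| < d -> `|f x - f y| <= 1)) := @segment_compact R (-2) 2.
case=> [x _|d /= d0 Hd].
  have [e e0 {}He] := He x.
  have e20 : 0 < e / 2 by lra.
  near=> z d => y /= zy.
  apply: (near_le1 x z y d e He _ _ zy).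
  - by near: z; exact: (nbhsx_ballx x).
  - by near: d; exact: nbhs_right_lt.
have {Hd} := Hd (Num.min (d/2) 1).
rewrite /ball/= sub0r normrN ger0_norm; last by rewrite le_min; apply/andP; split; lra.
set e := Num.min _ _.
have e0 : 0 < e by rewrite lt_min; apply/andP; split; lra.
have ed : e < d by rewrite /e minEle; case: ifP; lra.
move=> /(_ ed e0) {}He.
have k0 : 0 <= k by have := fk 0; lra.
(* At distance at least [e], the slope [k / e] already absorbs the full range [k] of [f]; at smaller
   distance the additive [1] suffices. *)
exists (k / e) => s t.
have [ste|ste] := ltP `|s - t| e; last first.
  have h : `|f s - f t| <= k by have := fk s; have := fk t; rewrite ler_norml; lra.
  suff : k <= k / e * `|s - t| by lra.
  by rewrite -mulrA ler_peMr// mulrC ler_pdivlMr// mul1r.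
suff : `|f s - f t| <= 1.
  move=> h; apply: (le_trans h); rewrite lerDl mulr_ge0// divr_ge0//; exact: ltW.
have [hs|hs] := leP `|s| 2.
  by apply: He => //=; rewrite in_itv/= -ler_norml.
have [ht|ht] := leP `|t| 2.
  by rewrite distrC; apply: He; rewrite 1?distrC//= in_itv/= -ler_norml.
rewrite !f0 ?subrr ?normr0//; lra.
Unshelve. all: end_near. Qed.

(** Integrating from [-oo] gives one formula valid on both sides of [0]. The integral converges
    because [f] agrees with its restriction to [[-1, 1]]; subtracting [G 0] normalises the
    primitive. *)
Lemma antiderivative (R : realType) (f : R -> R) :
  continuous f -> (forall t, 1 <= `|t| -> f t = 0) ->
  exists F : R -> R, F 0 = 0 /\ forall x : R, is_derive x 1 F (f x).
Proof.
move=> cf f0.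
have fi u : (@lebesgue_measure R).-integrable `]-oo, u] (EFin \o f).
  have mf : measurable_fun [set: R] f by exact: continuous_measurable_fun.
  apply: (@integrableS _ _ _ _ setT) => //.
  have -> : EFin \o f = (EFin \o f) \_ `[-1, 1]%classic.
    apply/funext => x; rewrite patchE; case: ifPn => // /negP xn.
    rewrite /= f0//; rewrite leNgt; apply/negP => /ltW h; apply: xn.
    by rewrite inE/= in_itv/= -ler_norml.
  apply: (iffLR (@integrable_mkcond _ _ R (@lebesgue_measure R)
    `[-1, 1]%classic (EFin \o f) _)) => //.
  apply: continuous_compact_integrable; first exact: segment_compact.
  exact: continuous_subspaceT.
pose G x := (\int[@lebesgue_measure R]_(t in `]-oo, x]) f t)%R.
exists (fun x => G x - G 0); rewrite subrr; split=> // x.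
have [dG G'] : derivable G x 1 /\ derive1 G x = f x.
  by apply: (@continuous_FTC1 R f -oo%O x (x + 1)) => //; [lra | by rewrite ltNyr | exact: cf].
rewrite -(subr0 (f x)); apply: is_deriveB.
by apply: DeriveDef; [exact: dG | rewrite -derive1E; exact: G'].
Qed.

Lemma antiderivative_lip (R : realType) (f F : R -> R) (k : R) :
  (forall t, 0 <= f t <= k) -> (forall x : R, is_derive x 1 F (f x)) ->
  forall s t, `|F s - F t| <= k * `|s - t|.
Proof.
move=> fk dF s t.
wlog st : s t / t <= s.
  move=> h; have [/h//|/ltW/h] := leP t s.
  by rewrite distrC (distrC s).
have cF : {within `[t, s], continuous F}.
  by apply: continuous_subspaceT; exact: is_derive_continuous dF.
have [c _ ->] := @MVT_segment R F f t s st (fun x _ => dF x) cF.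
have fc := fk c.
by rewrite normrM ler_wpM2r// ger0_norm; lra.
Qed.

Lemma antiderivative_integral (R : realType) (f F : R -> R) (a b : R) :
  continuous f -> (forall x : R, is_derive x 1 F (f x)) -> a <= b ->
  (\int[@lebesgue_measure R]_(t in `[a, b]) (f t)%:E = (F b - F a)%:E)%E.
Proof.
move=> cf dF; rewrite le_eqVlt => /orP[/eqP ->|ab].
  by rewrite set_itv1 integral_set1 subrr.
have cF := is_derive_continuous dF.
rewrite (@continuous_FTC2 R f F)//.
- exact: continuous_subspaceT.
- split.
  + by move=> x _; case: (dF x).
  + exact/cvg_at_right_filter/cF.
  + exact/cvg_at_left_filter/cF.
- by move=> x _; rewrite derive1E; case: (dF x).
Qed.

(** * Truncations of [phi] capped by multiples of a tent function *)

Definition tent (R : realType) (t : R) : R := Num.max 0 (1 - `|t|).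

(* Continuous compactly supported truncations increasing to the positive part
   of [phi] on ]-1, 1[. *)
Definition trunc (R : realType) (phi : R -> \bar R) (n : nat) (t : R) : R :=
  fine (maxe 0 (mine (phi t) (n%:R * tent t)%:E))%E.

Section truncation.
Variables (R : realType) (phi : R -> \bar R).
Hypothesis phiNy : forall s, phi s != -oo%E.

Lemma tent_bounds (t : R) : 0 <= tent t <= 1.
Proof. by rewrite /tent maxEle; case: ifP; have := normr_ge0 t; lra. Qed.

Lemma tent_support (t : R) : 1 <= `|t| -> tent t = 0.
Proof. by rewrite /tent => t1; apply/max_idPl; lra. Qed.

Lemma tent_gt0 (t : R) : `|t| < 1 -> 0 < tent t.
Proof. by rewrite /tent lt_max => t1; apply/orP; right; lra. Qed.

Lemma continuous_tent : continuous (@tent R).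
Proof.
move=> x; apply: (@continuous_max _ _ (cst 0) (fun t => 1 - `|t|)); first exact: cvg_cst.
by apply: cvgB; [exact: cvg_cst | exact: norm_continuous].
Qed.

Lemma truncE n t :
  (trunc phi n t)%:E = maxe 0%E (mine (phi t) (n%:R * tent t)%:E).
Proof.
rewrite /trunc fineK//; have := phiNy t.
by case: (phi t) => [r| |]// _; rewrite ?minye// -?EFin_min -?EFin_max.
Qed.

Lemma trunc_fin n t r : phi t = r%:E ->
  trunc phi n t = Num.max 0 (Num.min r (n%:R * tent t)).
Proof. by rewrite /trunc => ->; rewrite -EFin_min -EFin_max. Qed.

Lemma trunc_pinfty n t : phi t = +oo%E -> trunc phi n t = n%:R * tent t.
Proof.
rewrite /trunc => ->; rewrite minye -EFin_max/=; apply/max_idPr.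
by rewrite mulr_ge0//; have /andP[] := tent_bounds t.
Qed.

Lemma trunc_bounds n t : 0 <= trunc phi n t <= n%:R.
Proof.
have nT : 0 <= n%:R * tent t <= n%:R.
  have /andP[T0 T1] := tent_bounds t.
  by rewrite mulr_ge0//= ler_piMr.
case phitE : (phi t) => [r| |]; last by have := phiNy t; rewrite phitE.
- by rewrite (trunc_fin _ phitE) maxEle minEle; case: ifP; case: ifP; lra.
- by rewrite (trunc_pinfty _ phitE).
Qed.

Lemma trunc_support n t : 1 <= `|t| -> trunc phi n t = 0.
Proof.
move=> /tent_support t0.
case phitE : (phi t) => [r| |]; last by have := phiNy t; rewrite phitE.
- by rewrite (trunc_fin _ phitE) t0 mulr0 maxEle minEle; case: ifP; case: ifP; lra.
- by rewrite (trunc_pinfty _ phitE) t0 mulr0.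
Qed.

(** The bound does not involve [n]: composed with [u], it dominates all truncations by the single
    L^2 function [phi(u)]. *)
Lemma trunc_le_fine n t : phi t \is a fin_num -> trunc phi n t <= `|fine (phi t)|.
Proof.
move=> /fineK h; rewrite (@trunc_fin n t (fine (phi t)))//.
have := ler_norm (fine (phi t)); have := normr_ge0 (fine (phi t)).
by rewrite maxEle minEle; case: ifP; case: ifP; lra.
Qed.

Lemma trunc_nd t m n : (m <= n)%N -> trunc phi m t <= trunc phi n t.
Proof.
move=> mn; rewrite -lee_fin !truncE; apply: le_max2 => //.
apply: le_min2 => //; rewrite lee_fin ler_wpM2r ?ler_nat//.
by have /andP[] := tent_bounds t.
Qed.

(** Near a point where [phi] is finite, the truncation is a max and min of continuous real
    functions. Near a point where [phi] is [+oo], [phi] exceeds [n], hence the cap [n%:R * tent t],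
    so the truncation coincides with the cap. *)
Lemma continuous_trunc n : continuous phi -> continuous (trunc phi n).
Proof.
move=> cphi x.
have cT : {for x, continuous (fun t => n%:R * tent t)}.
  by apply: cvgMr; exact: continuous_tent.
have := cphi x; rewrite /continuous_at.
case phix : (phi x) => [r| |]; last by have := phiNy x; rewrite phix.
  move=> phir; have cfine : (fine \o phi) @ x --> (fine \o phi) x.
    by rewrite /= phix; exact: fine_cvg phir.
  have near_trunc : \forall t \near x,
      Num.max 0 (Num.min (fine (phi t)) (n%:R * tent t)) = trunc phi n t.
    have := cvg_is_fine phir; apply: filterS => t /fineK h.
    by rewrite (@trunc_fin n t (fine (phi t))).
  rewrite (trunc_fin _ phix); apply: (cvg_trans (near_eq_cvg near_trunc)).
  have -> : r = fine (phi x) by rewrite phix.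
  apply: (@continuous_max _ _ (cst 0) (fun t => Num.min (fine (phi t)) (n%:R * tent t))).
    exact: cvg_cst.
  apply: (@continuous_min _ _ (fun t => fine (phi t)) (fun t => n%:R * tent t)) => //.
move=> /cvgey_gt/(_ n%:R) phin; rewrite (trunc_pinfty _ phix).
apply: cvg_trans cT; apply: near_eq_cvg; apply: filterS phin => t phit.
case phitE : (phi t) => [r| |]; last by have := phiNy t; rewrite phitE.
  rewrite (trunc_fin _ phitE); move: phit; rewrite phitE lte_fin.
  have /andP[T0 T1] := tent_bounds t.
  have := ler_piMr (ler0n _ n : 0 <= n%:R :> R) T1.
  have := mulr_ge0 (ler0n _ n : 0 <= n%:R :> R) T0.
  by rewrite maxEle minEle; case: ifP; case: ifP; lra.
by rewrite (trunc_pinfty _ phitE).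
Qed.

(** Since [tent t] is positive, the cap tends to [+oo]. If [phi t] is finite, the sequence is
    eventually constant; otherwise it is the cap itself. *)
Lemma trunc_cvg t : `|t| < 1 ->
  (trunc phi n t)%:E @[n --> \oo] --> (phi^\+ t)%E.
Proof.
move=> /tent_gt0 T0.
have large A : \forall n \near \oo, A <= n%:R * tent t.
  exists (Num.bound `|A / tent t|) => // n /= hn.
  rewrite -ler_pdivrMr//; apply: le_trans (ler_norm _) _; apply: ltW.
  by apply: (lt_le_trans (archi_boundP (normr_ge0 _))); rewrite ler_nat.
rewrite funeposE; case phitE : (phi t) => [r| |]; last by have := phiNy t; rewrite phitE.
  rewrite -EFin_max; apply: cvg_EFin; first exact: nearW.
  apply: cvg_near_cst; apply: filterS (large r) => n hn /=.
  by rewrite (trunc_fin _ phitE) maxC; move/min_idPl : hn => ->.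
rewrite maxye; apply/cvgeyPge => A; apply: filterS (large A) => n.
by rewrite (trunc_pinfty _ phitE) lee_fin.
Qed.

End truncation.

Lemma measurable_trunc (R : realType) (phi : R -> \bar R) n (D : set R) :
  (forall s, phi s != -oo%E) -> continuous phi ->
  measurable_fun D (fun t => (trunc phi n t)%:E).
Proof.
move=> phiNy cphi.
have ct : continuous (trunc phi n) by exact: continuous_trunc.
by apply/measurable_EFinP; exact: measurable_funTS (continuous_measurable_fun ct).
Qed.

Lemma integral_trunc_cvgy (R : realType) (phi : R -> \bar R) (I : set R) :
  (forall s, phi s != -oo%E) -> continuous phi -> measurable I ->
  (forall t, I t -> `|t| < 1) ->
  (\int[@lebesgue_measure R]_(t in I) phi t = +oo)%E ->
  (\int[@lebesgue_measure R]_(t in I) (trunc phi n t)%:E)%E @[n --> \oo] --> +oo%E.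
Proof.
move=> phiNy cphi mI I1 phiI.
have <- : (\int[@lebesgue_measure R]_(t in I)
    (fun t => limn (fun n => (trunc phi n t)%:E)) t = +oo)%E.
  transitivity (\int[@lebesgue_measure R]_(t in I) (phi^\+ t))%E.
    apply: eq_integral => t; rewrite inE => /I1 t1.
    by apply/cvg_lim => //; exact: trunc_cvg.
  (* The integral of [phi] is that of [phi^\+] minus that of [phi^\-], both nonnegative. Since
     [+oo - +oo] is [-oo] by convention, the value [+oo] forces the first integral to be [+oo]. *)
  move: phiI; rewrite integralE.
  have : (0 <= \int[@lebesgue_measure R]_(t in I) (phi^\+ t))%E by exact: integral_ge0.
  have : (0 <= \int[@lebesgue_measure R]_(t in I) (phi^\- t))%E by exact: integral_ge0.
  by do 2 case: (integral _ _ _) => [?| |].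
apply: cvg_monotone_convergence => //.
- by move=> n; exact: measurable_trunc.
- by move=> n t _; rewrite lee_fin; have /andP[] := trunc_bounds phiNy n t.
- by move=> t _ m n mn; rewrite lee_fin; exact: trunc_nd.
Qed.

(** The min and max bounds treat both signs of [s] at once; nonnegativity of the integral then
    determines the sign of [F s]. *)
Lemma antiderivative_abs (R : realType) (f F : R -> R) (s : R) :
  continuous f -> (forall t, 0 <= f t) -> (forall x : R, is_derive x 1 F (f x)) -> F 0 = 0 ->
  (`|F s|%:E = \int[@lebesgue_measure R]_(t in `[(Num.min 0 s)%R, (Num.max 0 s)%R]) (f t)%:E)%E.
Proof.
move=> cf f0 dF F0.
have ss : Num.min 0 s <= Num.max 0 s by rewrite ge_min !le_max !lexx.
have : (0 <= \int[@lebesgue_measure R]_(t in `[(Num.min 0 s)%R, (Num.max 0 s)%R]) (f t)%:E)%E.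
  by apply: integral_ge0 => t _; rewrite lee_fin.
rewrite (antiderivative_integral cf dF ss) lee_fin.
have [s0|s0] := leP 0 s; rewrite F0.
  by rewrite subr0 => ?; rewrite ger0_norm.
by rewrite sub0r oppr_ge0 => ?; rewrite ler0_norm.
Qed.

(** * Primitives of the truncations: monotonicity in [n] and divergence away from [0] *)

Section primitives.
Variables (R : realType) (phi : R -> \bar R) (F : nat -> R -> R).
Hypotheses (phiNy : forall s, phi s != -oo%E) (cphi : continuous phi).
Hypothesis dF : forall n (x : R), is_derive x 1 (F n) (trunc phi n x).
Hypothesis F0 : forall n, F n 0 = 0.

Let F_abs n s : (`|F n s|%:E =
  \int[@lebesgue_measure R]_(t in `[(Num.min 0 s)%R, (Num.max 0 s)%R]) (trunc phi n t)%:E)%E.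
Proof.
apply: antiderivative_abs => //; first exact: continuous_trunc.
by move=> t; have /andP[] := trunc_bounds phiNy n t.
Qed.

Let trunc_ge0 n t : (0 <= (trunc phi n t)%:E)%E.
Proof. by rewrite lee_fin; have /andP[] := trunc_bounds phiNy n t. Qed.

Lemma antiderivative_trunc_nd s m n : (m <= n)%N -> `|F m s| <= `|F n s|.
Proof.
move=> mn; rewrite -lee_fin !F_abs.
by apply: ge0_le_integral => //; try exact: measurable_trunc;
  move=> t _; rewrite lee_fin trunc_nd.
Qed.

Lemma antiderivative_trunc_cvgy s :
  (forall delta : R, 0 < delta < 1 ->
     (\int[@lebesgue_measure R]_(t in `[0%R, delta]) phi t = +oo)%E /\
     (\int[@lebesgue_measure R]_(t in `[(- delta)%R, 0%R]) phi t = +oo)%E) ->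
  s != 0 -> `|F n s|%:E @[n --> \oo] --> +oo%E.
Proof.
move=> phi_div s_neq0.
suff [I [mI I1 phiI Is]] : exists I : set R, [/\ measurable I,
    forall t, I t -> `|t| < 1, (\int[@lebesgue_measure R]_(t in I) phi t = +oo)%E &
    I `<=` `[(Num.min 0 s)%R, (Num.max 0 s)%R]].
  apply: gee_cvgy (integral_trunc_cvgy phiNy cphi mI I1 phiI).
  apply: nearW => n; rewrite F_abs.
  by apply: ge0_subset_integral => //; exact: measurable_trunc.
(* The bound [1 / 2] keeps the interval inside []-1, 1[], where the truncations increase to
   [phi^\+]; the bound [|s|] keeps it between [0] and [s]. *)
pose d := Num.min `|s| (1 / 2).
have d0 : 0 < d by rewrite lt_min normr_gt0 s_neq0/=; lra.
have d12 : d <= 1 / 2 by rewrite ge_min lexx orbT.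
have ds : d <= `|s| by rewrite ge_min lexx.
have [|phiR phiL] := phi_div d; first lra.
have [s0|s0] := ltP 0 s.
  exists `[0, d]%classic; split=> //= t /=; rewrite in_itv/= => td.
    by rewrite ltr_norml; lra.
  by move: ds; rewrite gtr0_norm// in_itv/= => ?; lra.
exists `[- d, 0]%classic; split=> //= t /=; rewrite in_itv/= => td.
  by rewrite ltr_norml; lra.
by move: ds; rewrite ler0_norm// in_itv/= => ?; lra.
Qed.

End primitives.

(** * The interval, test functions, and a pointwise energy inequality *)

Lemma measurable_I0L (R : realType) (L : R) : measurable (I0L L : set R).
Proof. exact: measurable_itv. Qed.
Lemma lebesgue_measure_I0L (R : realType) (L : R) : 0 < L ->
  @lebesgue_measure R (I0L L) = L%:E.
Proof.
by move=> L0; rewrite /I0L lebesgue_measure_itv/= lte_fin L0 -EFinD subr0.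
Qed.

Section test_functions.
Variables (R : realType) (L : R) (psi : R -> R).
Hypothesis psi_test : test_fun L psi.

Lemma test_fun_is_derive (x : R) : is_derive x 1 psi (derive1 psi x).
Proof.
have [/(_ 0%N x) d _] := psi_test.
by apply: DeriveDef; [exact: d | rewrite derive1E].
Qed.

Lemma test_fun_continuous : continuous psi.
Proof. exact: is_derive_continuous test_fun_is_derive. Qed.

Lemma test_fun_derive_continuous : continuous (derive1 psi).
Proof.
move=> x; apply: differentiable_continuous; apply/derivable1_diffP.
by have [/(_ 1%N x)] := psi_test.
Qed.

Lemma test_fun0 : psi 0 = 0.
Proof. by have [_ [c [d [c0 _ _ psi0]]]] := psi_test; apply: psi0; left. Qed.

(** The fundamental theorem of calculus on [[0, x]] for [F \o psi], which vanishes at [0] because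
    [psi] and [F] do. *)
Lemma test_fun_comp_bound (f F : R -> R) (x : R) : continuous f ->
  (forall x : R, is_derive x 1 F (f x)) -> F 0 = 0 -> 0 < x < L ->
  (`|F (psi x)|%:E <=
   \int[@lebesgue_measure R]_(y in I0L L) `|f (psi y) * derive1 psi y|%:E)%E.
Proof.
move=> cf dF F0 /andP[x0 xL].
pose h y := f (psi y) * derive1 psi y.
have ch : continuous h.
  move=> y; apply: cvgM; last exact: test_fun_derive_continuous.
  by apply: continuous_comp; [exact: test_fun_continuous | exact: cf].
have dh (y : R) : is_derive y 1 (F \o psi) (h y).
  by apply: is_derive1_comp; exact: test_fun_is_derive.
have mh D : measurable_fun D (fun y => (h y)%:E).
  by apply/measurable_EFinP; exact: measurable_funTS (continuous_measurable_fun ch).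
have mnh D : measurable_fun D (fun y => `|h y|%:E).
  apply/measurable_EFinP; apply: (measurableT_comp (@normr_measurable R setT)).
  by apply/measurable_EFinP.
have := antiderivative_integral ch dh (ltW x0).
rewrite /= test_fun0 F0 subr0 => hE.
have -> : `|F (psi x)|%:E = `|(F (psi x))%:E|%E by [].
rewrite -hE; apply: (le_trans (le_abse_integral _ _ _)) => //=; first exact: mh.
(* Endpoints are dropped because [0] does not belong to [I0L L]. *)
rewrite (@integral_itv_bndoo _ _ _ _ true false); last exact: mnh.
apply: ge0_subset_integral => //; [exact: measurable_I0L|exact: (mnh (I0L L))|].
by move=> y; rewrite /I0L/= !in_itv/= => /andP[-> /lt_trans]; exact.
Qed.

End test_functions.

(** Here [p], [q] stand for a test function and its derivative, [u], [v] for the function and weak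
    derivative that they approximate, [fp], [fu] for values of a truncation, and [w] for [phi(u)].
    The constants [C] and [k] of the truncation multiply only the approximation errors, which can be
    made small. *)
Lemma energy_density_bound (R : realType) (C k u v w p q fp fu : R) :
  0 <= fp <= k -> `|fp - fu| <= 1 + C * `|p - u| -> fu <= `|w| ->
  `|fp * q| <= (w ^+ 2 + 3 * v ^+ 2 + 2) +
    (C ^+ 2 + k ^+ 2) * ((p - u) ^+ 2 + (q - v) ^+ 2).
Proof.
move=> fpk fpu fuw.
have fp_le : fp <= `|w| + 1 + C * `|p - u|.
  by have := ler_norm (fp - fu); lra.
have q_le : `|q| <= `|v| + `|q - v| by have := ler_normD v (q - v); rewrite subrKC.
rewrite normrM ger0_norm; last by lra.
(* The estimate of [fp] through [w] is paired with [|v|], and the crude bound [k] only with the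
   error [|q - v|]. *)
apply: (@le_trans _ _ ((`|w| + 1 + C * `|p - u|) * `|v| + k * `|q - v|)).
  apply: (@le_trans _ _ (fp * `|v| + fp * `|q - v|)).
    by rewrite -mulrDr; apply: ler_wpM2l => //; lra.
  by apply: lerD; apply: ler_wpM2r => //; lra.
(* Young's inequality on each of the products. *)
have sq (x : R) : x ^+ 2 = `|x| ^+ 2 by rewrite real_normK// num_real.
rewrite (sq w) (sq v) (sq (p - u)) (sq (q - v)).
have := normr_ge0 w; have := normr_ge0 v; have := normr_ge0 (p - u).
move: `|w| `|v| `|p - u| `|q - v| => W V A B A0 V0 W0.
have := sqr_ge0 (W - V); have := sqr_ge0 (1 - V); have := sqr_ge0 (C * A - V).
have := sqr_ge0 (k * B - 1).
have := sqr_ge0 (C * B); have := sqr_ge0 (k * A); have := sqr_ge0 (C * A).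
have := sqr_ge0 (k * B); have := sqr_ge0 V; have := sqr_ge0 W.
nra.
Qed.

(** * The energy estimate, uniform over the truncations *)

Section energy.
Variables (R : realType) (L k C : R) (u v w f F : R -> R).
Hypotheses (L0 : 0 < L) (uv : H10_with L u v) (Lw : L2 L w).
Hypotheses (cf : continuous f) (f_bounds : forall t, 0 <= f t <= k).
Hypothesis f_lip : forall s t, `|f s - f t| <= 1 + C * `|s - t|.
Hypotheses (dF : forall x : R, is_derive x 1 F (f x)) (F0 : F 0 = 0).
Hypothesis fuw : {ae @lebesgue_measure R, forall x, I0L L x -> f (u x) <= `|w x|}.

Let mu := @lebesgue_measure R.
Let D := I0L L.
Let h x := w x ^+ 2 + 3 * v x ^+ 2 + 2.
Let M := C ^+ 2 + k ^+ 2.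

Let mD : measurable D. Proof. exact: measurable_I0L. Qed.

Lemma energy_density_integrable : mu.-integrable D (EFin \o h).
Proof.
have [[_ [_ iv] _] _] := uv; have [_ iw] := Lw.
have -> : EFin \o h =
    ((fun x => (w x ^+ 2)%:E) \+ (fun x => 3%:E * (v x ^+ 2)%:E) \+ cst 2%:E)%E.
  by apply/funext => x; rewrite /h /= !EFinD EFinM.
apply: integrableD => //; first apply: integrableD => //; first exact: integrableZl.
apply/integrableP; split; first exact: measurable_cst.
by rewrite integral_cst//= (lebesgue_measure_I0L L0) -EFinM ltry.
Qed.

(** The right-hand side depends on [v], [w] and [L] but not on [f], [k] or [C]. The approximating
    test function is chosen after these, close enough for their contribution to stay below a fixed
    constant. *)
Lemma energy_bound : (\int[mu]_(x in D) `|F (u x)|%:E <=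
  ((fine (\int[mu]_(x in D) (h x)%:E) + 2) * L + 1)%:E)%E.
Proof.
have [[[mu_ _] [mv _] _] [psi [psi_test [cvgA cvgB]]]] := uv.
have [mw _] := Lw.
have M0 : 0 <= M by rewrite addr_ge0// sqr_ge0.
(* With this tolerance, [M] times the sum of the two squared L^2 errors is at most [1]; using
   [M + 1] keeps the inverse positive when [M] is [0]. *)
have eta0 : 0 < (2 * (M + 1))^-1 by rewrite invr_gt0; lra.
have Meta : M * (2 * (M + 1))^-1 <= 1 / 2.
  by rewrite ler_pdivrMr; lra.
have small (g : nat -> \bar R) : g @ \oo --> 0%E ->
    \forall n \near \oo, (g n <= (2 * (M + 1))^-1%:E)%E.
  move=> /fine_cvgP[gfin /cvgrPdist_lt/(_ _ eta0)]; apply: filterS2 gfin => n /fineK <-.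
  by rewrite /= sub0r normrN lee_fin => /ltW; exact: (le_trans (ler_norm _)).
have [n [An Bn]] : exists n,
    (\int[mu]_(x in D) ((psi n x - u x) ^+ 2)%:E <= (2 * (M + 1))^-1%:E)%E /\
    (\int[mu]_(x in D) ((derive1 (psi n) x - v x) ^+ 2)%:E <= (2 * (M + 1))^-1%:E)%E.
  have := filterI (small _ cvgA) (small _ cvgB).
  by case=> n _ /(_ n (leqnn n)); exists n.
move: (psi n) (psi_test n) An Bn => {cvgA cvgB psi_test}psi psi_test An Bn.
have cpsi := test_fun_continuous psi_test.
have cdpsi := test_fun_derive_continuous psi_test.
have mpsi : measurable_fun D psi := measurable_funTS (continuous_measurable_fun cpsi).
have mdpsi : measurable_fun D (derive1 psi) :=
  measurable_funTS (continuous_measurable_fun cdpsi).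
have mA : measurable_fun D (fun x => ((psi x - u x) ^+ 2)%:E).
  by apply/measurable_EFinP; apply: measurable_funX; exact: measurable_funB.
have mB : measurable_fun D (fun x => ((derive1 psi x - v x) ^+ 2)%:E).
  by apply/measurable_EFinP; apply: measurable_funX; exact: measurable_funB.
have cF := is_derive_continuous dF.
have mFu : measurable_fun D (fun x => `|F (u x)|%:E).
  apply/measurable_EFinP; apply: (measurableT_comp (@normr_measurable R setT)).
  by apply: measurableT_comp => //; exact: continuous_measurable_fun.
have mfpsi : measurable_fun D (fun x => `|f (psi x) * derive1 psi x|%:E).
  apply/measurable_EFinP; apply: (measurableT_comp (@normr_measurable R setT)).
  apply: measurable_funM => //.
  by apply: measurableT_comp => //; exact: continuous_measurable_fun.
have /integrableP[mh _] := energy_density_integrable.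
have h0 x : 0 <= h x.
  by rewrite /h; have := sqr_ge0 (w x); have := sqr_ge0 (v x); lra.
have ih : (\int[mu]_(x in D) (h x)%:E = (fine (\int[mu]_(x in D) (h x)%:E))%:E)%E.
  by rewrite fineK//; exact: integrable_fin_num energy_density_integrable.
move: (fine (\int[mu]_(x in D) (h x)%:E)) ih => H ih.
have int_psi : (\int[mu]_(x in D) `|f (psi x) * derive1 psi x|%:E <=
    (H + 1)%:E)%E.
  apply: (@le_trans _ _ (\int[mu]_(x in D) ((h x)%:E +
      M%:E * (((psi x - u x) ^+ 2)%:E + ((derive1 psi x - v x) ^+ 2)%:E)))%E).
    apply: ae_ge0_le_integral => //.
    - move=> x _; rewrite -(EFinD (_ ^+ 2)) -EFinM -EFinD lee_fin.
      by rewrite addr_ge0// mulr_ge0// addr_ge0// sqr_ge0.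
    - by apply: emeasurable_funD => //; apply: measurable_funeM; exact: emeasurable_funD.
    - move: fuw; apply: filterS; first exact: (ae_filter_ringOfSetsType mu).
      move=> x fuwx Dx.
      rewrite -(EFinD (_ ^+ 2)) -EFinM -EFinD lee_fin.
      exact: energy_density_bound (f_bounds _) (f_lip _ _) (fuwx Dx).
  rewrite ge0_integralD//; last 3 first.
  - by move=> x _; rewrite lee_fin.
  - by move=> x _; rewrite -(EFinD (_ ^+ 2)) -EFinM lee_fin mulr_ge0// addr_ge0// sqr_ge0.
  - by apply: measurable_funeM; exact: emeasurable_funD.
  rewrite ge0_integralZl_EFin//; last 2 first.
  - by move=> x _; rewrite -EFinD lee_fin addr_ge0// sqr_ge0.
  - exact: emeasurable_funD.
  rewrite ge0_integralD//; try by move=> x _; rewrite lee_fin sqr_ge0.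
  rewrite (EFinD H) ih; apply: leeD => //.
  apply: (@le_trans _ _ (M%:E * ((2 * (M + 1))^-1%:E + (2 * (M + 1))^-1%:E))%E).
    by apply: lee_wpmul2l; [rewrite lee_fin | exact: leeD].
  by rewrite -EFinD -EFinM lee_fin; lra.
(* Return from [psi] to [u]: [|F(u)| <= |F(psi)| + k z] with [z = |psi - u|], where
   [|F(psi)| <= H + 1] pointwise and [k z <= 1 + k^2 z^2]. *)
apply: (@le_trans _ _ (\int[mu]_(x in D) ((H + 2)%:E +
      M%:E * ((psi x - u x) ^+ 2)%:E))%E).
  apply: ge0_le_integral => //.
  - by apply: emeasurable_funD; [exact: measurable_cst | exact: measurable_funeM].
  - move=> x Dx; rewrite -EFinM -EFinD lee_fin.
    have : (`|F (psi x)|%:E <= (H + 1)%:E)%E.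
      apply: le_trans int_psi.
      by apply: test_fun_comp_bound => //; move: Dx; rewrite /D /I0L /= in_itv.
    rewrite lee_fin => Fpsi.
    have := antiderivative_lip f_bounds dF (u x) (psi x).
    have := ler_distD (F (psi x)) (F (u x)) 0; rewrite !subr0 distrC (distrC (u x)).
    have := sqr_ge0 (k * `|psi x - u x| - 1).
    have : (psi x - u x) ^+ 2 = `|psi x - u x| ^+ 2 by rewrite real_normK// num_real.
    rewrite /M => ->.
    have := sqr_ge0 (C * `|psi x - u x|); have := sqr_ge0 (k * `|psi x - u x|).
    move: `|psi x - u x| Fpsi => Z Fpsi; nra.
rewrite ge0_integralD//; last 3 first.
- move=> x _; rewrite lee_fin addr_ge0// -lee_fin -ih.
  by apply: integral_ge0 => y _; rewrite lee_fin.
- by move=> x _; rewrite -EFinM lee_fin mulr_ge0// sqr_ge0.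
- exact: measurable_funeM.
rewrite integral_cst// ge0_integralZl_EFin//; last by move=> x _; rewrite lee_fin sqr_ge0.
rewrite [X in (_ * X + _)%E](lebesgue_measure_I0L L0) -EFinM (EFinD ((H + 2) * L)).
apply: leeD => //; apply: (@le_trans _ _ (M%:E * (2 * (M + 1))^-1%:E)%E).
  by apply: lee_wpmul2l; [rewrite lee_fin | ].
by rewrite -EFinM lee_fin; lra.
Qed.

End energy.

(** * Contradiction by monotone convergence *)

Unset Implicit Arguments.

Theorem mainTheorem6 (R : realType) (L : R) (a g : R -> R)
  (phi : R -> \bar R) :
  0 < L -> H_a L a -> L2 L g -> H_phi phi -> phi 0 = +oo%E ->
  (forall delta : R, 0 < delta < 1 ->
     (\int[@lebesgue_measure R]_(t in `[0%R, delta]) phi t = +oo)%E /\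
     (\int[@lebesgue_measure R]_(t in `[(- delta)%R, 0%R]) phi t = +oo)%E) ->
  ~ exists u : R -> R, weak_solution L a g phi u.
Proof.
move=> L0 _ _ [cphi phiNy _] phi0 phi_div [u [v [uv [phiu_fin Lw] _]]].
have ctr n : continuous (trunc phi n) by exact: continuous_trunc.
have /choice[F F_spec] n := antiderivative (ctr n) (@trunc_support _ _ phiNy n).
have F0 n : F n 0 = 0 by case: (F_spec n).
have dF n (x : R) : is_derive x 1 (F n) (trunc phi n x) by case: (F_spec n).
have [K FuK] : exists K : R, forall n,
    (\int[@lebesgue_measure R]_(x in I0L L) `|F n (u x)|%:E <= K%:E)%E.
  (* The witness is read off from the energy bound by unification. It may precede [n] because that
     bound contains neither the truncation level nor its constant [C]. *)
  eexists => n.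
  have [C f_lip] := coarse_lipschitz (ctr n) (trunc_bounds phiNy n)
    (@trunc_support _ _ phiNy n).
  apply: (energy_bound L0 uv Lw (ctr n) (trunc_bounds phiNy n) f_lip (dF n) (F0 n)).
  move: phiu_fin; apply: filterS; first exact: (ae_filter_ringOfSetsType (@lebesgue_measure R)).
  by move=> x phiu Dx; exact: trunc_le_fine (phiu Dx).
have mD : measurable (I0L L : set R) := @measurable_I0L R L.
have mu_ : measurable_fun (I0L L) u by have [[[]]] := uv.
have mFu n : measurable_fun (I0L L) (fun x => `|F n (u x)|%:E).
  apply/measurable_EFinP; apply: (measurableT_comp (@normr_measurable R setT)).
  apply: measurableT_comp => //; apply: continuous_measurable_fun.
  exact: is_derive_continuous (dF n).
have nd_Fu x m n : (m <= n)%N -> (`|F m (u x)|%:E <= `|F n (u x)|%:E)%E.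
  by move=> mn; rewrite lee_fin; exact: (antiderivative_trunc_nd phiNy cphi dF F0).
have cvg_Fu x : (fun n => `|F n (u x)|%:E) @ \oo --> limn (fun n => `|F n (u x)|%:E).
  by apply: ereal_nondecreasing_is_cvgn => m n; exact: nd_Fu.
(* Monotone convergence carries the bound [K] to the limit, which is shown next to be [+oo] almost
   everywhere on an interval of positive length [L]. *)
have : (\int[@lebesgue_measure R]_(x in I0L L) limn (fun n => `|F n (u x)|%:E) <= K%:E)%E.
  rewrite monotone_convergence//; last by move=> x _ m n; exact: nd_Fu.
  apply: lime_le; last exact: nearW.
  apply: ereal_nondecreasing_is_cvgn; move=> m n mn.
  by apply: ge0_le_integral => //; [exact: mFu | exact: mFu | move=> x _; exact: nd_Fu].
rewrite (@ae_eq_integral _ _ _ (@lebesgue_measure R) _ (cst +oo%E))//.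
- by rewrite integral_cst//= (lebesgue_measure_I0L L0) gt0_mulye// lte_fin.
- by apply: emeasurable_fun_cvg mFu _ => x _; exact: cvg_Fu.
move: phiu_fin; apply: filterS; first exact: (ae_filter_ringOfSetsType (@lebesgue_measure R)).
move=> x phiu Dx; apply/cvg_lim => //.
apply: (antiderivative_trunc_cvgy phiNy cphi dF F0 phi_div).
by apply/eqP => ux0; move: (phiu Dx); rewrite ux0 phi0.
Qed.
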